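(* The tuples of integers $(g_1,\dots,g_k)$ with $k\ge2$, $1\le g_1\le\dots\le g_k$ and $\sum_{1\le i\le k}g_i=g$ such that $d\le 2g-3$, where $d=\sum_{1\le i<j\le k}g_ig_j$, are exactly the tuples (with these ordering and positivity constraints) of the form $(1,g-1)$, $(1,1,g-2)$, $(2,g-2)$ and $(3,3)$.
   Context: In the geometric setting, $d=\sum_{1\le i<j\le k}g_ig_j$ is the codimension of the class $t^*[\mathcal{A}_{g_1}\times\dots\times\mathcal{A}_{g_k}]$, the pullback under the Torelli map $t\colon\mathcal{M}^{ct}_g\to\mathcal{A}_g$ (from the moduli space of compact type curves of genus $g$ to the moduli space of principally polarized abelian varieties of dimension $g$) of the pushforward to $\mathcal{A}_g$ of the fundamental class under the product map $\mathcal{A}_{g_1}\times\dots\times\mathcal{A}_{g_k}\to\mathcal{A}_g$. *)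

(* Defs.v *)
From mathcomp Require Import all_boot all_order all_algebra.
Set Implicit Arguments.
Unset Strict Implicit.
Unset Printing Implicit Defensive.
Import Order.TTheory GRing.Theory Num.Theory.
Local Open Scope ring_scope.

(* Codimension of the class t^*[A_{g_1} x ... x A_{g_k}], i.e. the second
   elementary symmetric function of (g_1, ..., g_k). *)
Definition product_codim (k : nat) (gs : k.-tuple int) : int :=
  \sum_(i < k) \sum_(j < k | (i < j)%N) tnth gs i * tnth gs j.

(* Main.v *)
Require Import Defs.
From mathcomp Require Import all_boot all_order all_algebra.
From mathcomp Require Import zify ring.
Import Order.TTheory GRing.Theory Num.Theory.
Local Open Scope ring_scope.

(** Splitting off parts one at a time, [product_codim (x :: t)] is [x] times
    the sum of [t] plus [product_codim t], so the excess [d - (2 * g - 3)] can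
    be written down explicitly according to the number of parts.
    - For [(a, b)] it is [(a - 2) * (b - 2) - 1].  With [1 <= a <= b] this is
      nonpositive exactly when [a = 1], [a = 2] or [a = b = 3].
    - For [(a, b, c)] it is [(a + b - 2) * (c - 1) + (a - 1) * (b - 1)], a sum
      of nonnegative terms.  It is nonpositive only if both vanish; as [c] is
      the largest part, this forces [a = b = 1].
    - For [(a, b, c, e, ...)] let [S] be the sum of all parts from [c] on.
      Merging these into one part [S] keeps [g] and lowers [d] by the
      [product_codim] of the merged parts, which is at least [c * e >= 1].  The
      merged triple already has nonnegative excess, so the excess is
      positive: four or more parts never occur. *)

Lemma product_codim_cons (n : nat) (x : int) (t : n.-tuple int) :
  product_codim [tuple of x :: t] =
  x * (\sum_(i < n) tnth t i) + product_codim t.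
Proof.
rewrite /product_codim big_ord_recl; congr (_ + _).
  rewrite big_mkcond big_ord_recl /= add0r mulr_sumr.
  by apply: eq_bigr => i _; rewrite tnthS.
apply: eq_bigr => i _.
rewrite big_mkcond big_ord_recl /= add0r [RHS]big_mkcond.
by apply: eq_bigr => j _; rewrite !tnthS.
Qed.

Lemma sum_tuple_cons (n : nat) (x : int) (t : n.-tuple int) :
  \sum_(i < n.+1) tnth [tuple of x :: t] i = x + \sum_(i < n) tnth t i.
Proof.
by rewrite big_ord_recl; congr (_ + _); apply: eq_bigr => i _; rewrite tnthS.
Qed.

Lemma product_codim_nil (t : 0.-tuple int) : product_codim t = 0.
Proof. by rewrite /product_codim big_ord0. Qed.

Lemma product_codim_ge0 (n : nat) (t : n.-tuple int) :
  (forall i, 0 <= tnth t i) -> 0 <= product_codim t.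
Proof.
by move=> t_ge0; apply: sumr_ge0 => i _; apply: sumr_ge0 => j _; apply: mulr_ge0.
Qed.

Lemma pair_excess_le0 (a b : int) : 1 <= a -> a <= b ->
  a * b <= 2 * (a + b) - 3 <-> [\/ a = 1, a = 2 | a = 3 /\ b = 3].
Proof.
move=> a_ge1 le_ab; split=> [le_d | [-> | -> | [-> ->]]]; last by []; try lia.
have le_prod : (a - 2) * (b - 2) <= 1 by lia.
have a_le3 : a <= 3 by nia.
have : [\/ a = 1, a = 2 | a = 3].
  have [-> | ne1] := eqVneq a 1; first by constructor 1.
  have [-> | ne2] := eqVneq a 2; first by constructor 2.
  by constructor 3; lia.
case=> ea; [by constructor 1 | by constructor 2 | constructor 3].
by split=> //; subst a; lia.
Qed.

Lemma triple_excess (a b c : int) :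
  a * (b + c) + b * c - (2 * (a + b + c) - 3) =
  (a + b - 2) * (c - 1) + (a - 1) * (b - 1).
Proof. by ring. Qed.

Lemma triple_excess_ge0 (a b c : int) : 1 <= a -> 1 <= b -> 1 <= c ->
  2 * (a + b + c) - 3 <= a * (b + c) + b * c.
Proof.
move=> a_ge1 b_ge1 c_ge1; rewrite -subr_ge0 triple_excess.
by apply: addr_ge0; apply: mulr_ge0; lia.
Qed.

Lemma triple_excess_le0 (a b c : int) : 1 <= a -> a <= b -> b <= c ->
  a * (b + c) + b * c <= 2 * (a + b + c) - 3 <-> a = 1 /\ b = 1.
Proof.
move=> a_ge1 le_ab le_bc; rewrite -subr_le0 triple_excess; split; last first.
  by case=> -> ->; lia.
move=> excess_le0.
have b1 : b = 1.
  (* If [b >= 2] then [c >= 2], and the first product is already positive. *)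
  by have [//|b_neq1] := eqVneq b 1; nia.
by split; lia.
Qed.

(** The strict form of the merging argument: the merged triple has
    nonnegative excess, and unmerging adds at least [c * e]. *)
Lemma four_parts_excess_gt0 (n : nat) (gs : n.+4.-tuple int) :
  (forall i, 1 <= tnth gs i) ->
  2 * (\sum_(i < n.+4) tnth gs i) - 3 < product_codim gs.
Proof.
case/tupleP: gs => a gs; case/tupleP: gs => b gs.
case/tupleP: gs => c gs; case/tupleP: gs => e t ge1.
have a_ge1 : 1 <= a := ge1 ord0.
have b_ge1 : 1 <= b := ge1 (lift ord0 ord0).
have c_ge1 : 1 <= c := ge1 (lift ord0 (lift ord0 ord0)).
have e_ge1 : 1 <= e := ge1 (lift ord0 (lift ord0 (lift ord0 ord0))).
have t_ge0 i : 0 <= tnth t i.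
  have := ge1 (lift ord0 (lift ord0 (lift ord0 (lift ord0 i)))).
  by rewrite !tnthS; apply: le_trans.
rewrite !product_codim_cons !sum_tuple_cons.
have := product_codim_ge0 _ _ t_ge0.
have : 0 <= \sum_(i < n) tnth t i by apply: sumr_ge0.
move: (\sum_(i < n) _) (product_codim t) => T D T_ge0 D_ge0.
have merged_triple : 2 * (a + b + (c + (e + T))) - 3 <=
    a * (b + (c + (e + T))) + b * (c + (e + T)).
  by apply: triple_excess_ge0; lia.
have merging_gain : 1 <= c * (e + T) by nia.
have eT_ge0 : 0 <= e * T by apply: mulr_ge0; lia.
lia.
Qed.

Theorem proposition1p5 (k : nat) (g : int) (gs : k.-tuple int)
    (k_ge2 : (2 <= k)%N)
    (gs_ge1 : forall i : 'I_k, 1 <= tnth gs i)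
    (gs_sorted : forall i j : 'I_k, (i <= j)%N -> tnth gs i <= tnth gs j)
    (sum_gs : \sum_(i < k) tnth gs i = g) :
  product_codim gs <= 2 * g - 3 <->
  [\/ gs = [:: 1; g - 1] :> seq int,
      gs = [:: 1; 1; g - 2] :> seq int,
      gs = [:: 2; g - 2] :> seq int
    | gs = [:: 3; 3] :> seq int].
Proof.
case: k gs k_ge2 gs_ge1 gs_sorted sum_gs => [|[|[|[|k]]]] // gs _ ge1 sorted.
- case/tupleP: gs => a gs in ge1 sorted *; case/tupleP: gs => b t in ge1 sorted *.
  have a_ge1 : 1 <= a := ge1 ord0.
  have le_ab : a <= b := sorted ord0 (lift ord0 ord0) isT.
  rewrite !product_codim_cons product_codim_nil !sum_tuple_cons big_ord0.
  rewrite (tuple0 t) /= mulr0 !addr0 => <-.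
  split=> [/(pair_excess_le0 _ _ a_ge1 le_ab) [-> | -> | [-> ->]] | part_eq].
  + by constructor 1; congr [:: _; _]; lia.
  + by constructor 3; congr [:: _; _]; lia.
  + by constructor 4.
  + apply/(pair_excess_le0 _ _ a_ge1 le_ab).
    case: part_eq => // -[ea eb]; [by constructor 1 | by constructor 2 |].
    by constructor 3.
- case/tupleP: gs => a gs in ge1 sorted *; case/tupleP: gs => b gs in ge1 sorted *.
  case/tupleP: gs => c t in ge1 sorted *.
  have a_ge1 : 1 <= a := ge1 ord0.
  have le_ab : a <= b := sorted ord0 (lift ord0 ord0) isT.
  have le_bc : b <= c := sorted (lift ord0 ord0) (lift ord0 (lift ord0 ord0)) isT.
  rewrite !product_codim_cons product_codim_nil !sum_tuple_cons big_ord0.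
  rewrite (tuple0 t) /= mulr0 !addr0 addrA => <-.
  split=> [/(triple_excess_le0 _ _ _ a_ge1 le_ab le_bc) [-> ->] | part_eq].
    by constructor 2; congr [:: _; _; _]; lia.
  apply/(triple_excess_le0 _ _ _ a_ge1 le_ab le_bc).
  by case: part_eq => // -[-> -> _].
- move=> <-; split=> [|part_eq].
    by rewrite leNgt (four_parts_excess_gt0 _ _ ge1).
  by have := size_tuple gs; case: part_eq => ->.
Qed.
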